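(* Let $\mathfrak{L}$ be a left Leibniz algebra over a field $\mathbb{F}$. Then the category $\mathbf{mod}^{\mathrm{bi}}_{\mathrm{weak}}(\mathfrak{L})$ of finite-dimensional weak $\mathfrak{L}$-bimodules is a rigid symmetric monoidal category.
   Context: A left Leibniz algebra is an $\mathbb{F}$-vector space $\mathfrak{L}$ with a bilinear multiplication satisfying $x(yz)=(xy)z+y(xz)$ for all $x,y,z\in\mathfrak{L}$. A weak $\mathfrak{L}$-bimodule is an $\mathbb{F}$-vector space $M$ with bilinear left and right $\mathfrak{L}$-actions satisfying, for all $x,y\in\mathfrak{L}$, $m\in M$: (LLM) $(xy)\cdot m=x\cdot(y\cdot m)-y\cdot(x\cdot m)$ and (LML) $(x\cdot m)\cdot y=x\cdot(m\cdot y)-m\cdot(xy)$. Morphisms are $\mathbb{F}$-linear maps commuting with both actions. The monoidal structure is the tensor product $M\otimes N$ over $\mathbb{F}$ with actions $x\cdot(m\otimes n):=(x\cdot m)\otimes n+m\otimes(x\cdot n)$ and $(m\otimes n)\cdot x:=(m\cdot x)\otimes n+m\otimes(n\cdot x)$; the unit object is $\mathbb{F}$ with zero left and right actions; the associativity, commutativity (flip) and unit constraints are those of the category of $\mathbb{F}$-vector spaces. Rigid means that every object has a left dual and a right dual. The linear dual $M^*=\mathrm{Hom}_{\mathbb{F}}(M,\mathbb{F})$ of a weak $\mathfrak{L}$-bimodule carries the actions $(x\cdot\mu)(m):=-\mu(x\cdot m)$ and $(\mu\cdot x)(m):=-\mu(m\cdot x)$. *)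

(* Defs.v *)
From HB Require Import structures.
From mathcomp Require Import all_boot all_order all_algebra.

Set Implicit Arguments.
Unset Strict Implicit.
Unset Printing Implicit Defensive.

Import GRing.Theory.
Local Open Scope ring_scope.

(* Structures are given by their data; the axioms are predicates on the data. *)

Record cat_data := CatData {
  obj :> Type;
  mor : obj -> obj -> Type;
  idm : forall X, mor X X;
  compm : forall X Y Z, mor Y Z -> mor X Y -> mor X Z }.

Arguments mor {c} X Y.
Arguments idm {c} X.
Arguments compm {c X Y Z} g f.

Declare Scope cat_scope.
Delimit Scope cat_scope with cat.
Notation "g \oc f" := (compm g f)
  (at level 50, left associativity, format "g  \oc  f") : cat_scope.
Local Open Scope cat_scope.

Definition is_category (C : cat_data) : Prop :=
  [/\ forall (X Y : C) (f : mor X Y), f \oc idm X = f,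
      forall (X Y : C) (f : mor X Y), idm Y \oc f = f
    & forall (X Y Z T : C) (h : mor Z T) (g : mor Y Z) (f : mor X Y),
        h \oc (g \oc f) = (h \oc g) \oc f].

Definition inverse_mor (C : cat_data) (X Y : C) (f : mor X Y) (g : mor Y X) :=
  g \oc f = idm X /\ f \oc g = idm Y.

Definition is_iso (C : cat_data) (X Y : C) (f : mor X Y) : Prop :=
  exists g, inverse_mor f g.

Record symmetric_monoidal_data (C : cat_data) := SymmetricMonoidalData {
  tobj : C -> C -> C;
  tmor : forall X X' Y Y',
    mor X X' -> mor Y Y' -> mor (tobj X Y) (tobj X' Y');
  tunit : C;
  assoc : forall X Y Z, mor (tobj (tobj X Y) Z) (tobj X (tobj Y Z));
  assocV : forall X Y Z, mor (tobj X (tobj Y Z)) (tobj (tobj X Y) Z);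
  lunit : forall X, mor (tobj tunit X) X;
  runit : forall X, mor (tobj X tunit) X;
  braid : forall X Y, mor (tobj X Y) (tobj Y X) }.

Arguments tobj {C} s X Y.
Arguments tmor {C} s {X X' Y Y'} f g.
Arguments tunit {C} s.
Arguments assoc {C} s X Y Z.
Arguments assocV {C} s X Y Z.
Arguments lunit {C} s X.
Arguments runit {C} s X.
Arguments braid {C} s X Y.

Section Monoidal.
Variables (C : cat_data) (T : symmetric_monoidal_data C).
Local Notation "X [x] Y" := (tobj T X Y) (at level 40, left associativity).
Local Notation "f [X] g" := (tmor T f g) (at level 40, left associativity).
Local Notation "1" := (tunit T).
Local Notation a := (assoc T).
Local Notation a' := (assocV T).
Local Notation l := (lunit T).
Local Notation r := (runit T).
Local Notation s := (braid T).

Record is_monoidal : Prop := IsMonoidal {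
  tmor_id : forall X Y, idm X [X] idm Y = idm (X [x] Y);
  tmor_comp : forall X X' X'' Y Y' Y'' (f' : mor X' X'') (f : mor X X')
      (g' : mor Y' Y'') (g : mor Y Y'),
    (f' \oc f) [X] (g' \oc g) = (f' [X] g') \oc (f [X] g);
  assoc_inverse : forall X Y Z, inverse_mor (a X Y Z) (a' X Y Z);
  assoc_natural : forall X X' Y Y' Z Z'
      (f : mor X X') (g : mor Y Y') (h : mor Z Z'),
    a X' Y' Z' \oc ((f [X] g) [X] h) = (f [X] (g [X] h)) \oc a X Y Z;
  lunit_iso : forall X, is_iso (l X);
  lunit_natural : forall X X' (f : mor X X'),
    l X' \oc (idm 1 [X] f) = f \oc l X;
  runit_iso : forall X, is_iso (r X);
  runit_natural : forall X X' (f : mor X X'),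
    r X' \oc (f [X] idm 1) = f \oc r X;
  pentagon : forall W X Y Z,
    (idm W [X] a X Y Z) \oc a W (X [x] Y) Z \oc (a W X Y [X] idm Z) =
    a W X (Y [x] Z) \oc a (W [x] X) Y Z;
  triangle : forall X Y,
    (idm X [X] l Y) \oc a X 1 Y = r X [X] idm Y }.

Record is_symmetric : Prop := IsSymmetric {
  braid_natural : forall X X' Y Y' (f : mor X X') (g : mor Y Y'),
    s X' Y' \oc (f [X] g) = (g [X] f) \oc s X Y;
  braid_hexagon : forall X Y Z,
    a Y Z X \oc s X (Y [x] Z) \oc a X Y Z =
    (idm Y [X] s X Z) \oc a Y X Z \oc (s X Y [X] idm Z);
  braid_hexagonV : forall X Y Z,
    a' Z X Y \oc s (X [x] Y) Z \oc a' X Y Z =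
    (s X Z [X] idm Y) \oc a' X Z Y \oc (idm X [X] s Y Z);
  braid_invol : forall X Y, s Y X \oc s X Y = idm (X [x] Y) }.

(* The zigzag identities for a left dual Y of X say that the composites
     X -> (X [x] Y) [x] X -> X [x] (Y [x] X) -> X   and
     Y -> Y [x] (X [x] Y) -> (Y [x] X) [x] Y -> Y
   are identities; the inverse unit constraint at the source of each one has
   been moved to the other side. *)
Definition is_left_dual (X Y : C) : Prop :=
  exists (ev : mor (Y [x] X) 1) (coev : mor 1 (X [x] Y)),
    r X \oc (idm X [X] ev) \oc a X Y X \oc (coev [X] idm X) = l X /\
    l Y \oc (ev [X] idm Y) \oc a' Y X Y \oc (idm Y [X] coev) = r Y.

Definition is_right_dual (X Y : C) : Prop :=
  exists (ev : mor (X [x] Y) 1) (coev : mor 1 (Y [x] X)),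
    l X \oc (ev [X] idm X) \oc a' X Y X \oc (idm X [X] coev) = r X /\
    r Y \oc (idm Y [X] ev) \oc a Y X Y \oc (coev [X] idm Y) = l Y.

Definition is_rigid : Prop := forall X : C,
  (exists Y, is_left_dual X Y) /\ (exists Y, is_right_dual X Y).

Definition is_rigid_symmetric_monoidal_category : Prop :=
  [/\ is_category C, is_monoidal, is_symmetric & is_rigid].

End Monoidal.

Local Close Scope cat_scope.

(* The tensor product of two finite-dimensional spaces is modelled by the
   matrices of coordinates on the products of basis vectors; [tens_bilinear],
   [tens_liftE] and [tens_ext] give its universal property, through which all
   maps out of it are defined below. *)

Local Notation is_bilinear f := (bilinear_for *:%R *:%R f).

Lemma linear_coord (F : fieldType) (U W : vectType F) (f : U -> W) :
  linear f -> forall u,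
  f u = \sum_i coord (vbasis {: U}) i u *: f (vbasis {: U})`_i.
Proof.
move=> fl u; pose fM := GRing.isLinear.Build F U W *:%R f fl.
pose g : {linear U -> W} := HB.pack f fM.
rewrite -[LHS]/(g u) [in LHS](coord_vbasis (memvf u)) linear_sum.
by apply: eq_bigr => i _; rewrite linearZ_LR.
Qed.

Definition tensor (F : fieldType) (U V : vectType F) : Type :=
  'M[F]_(\dim {: U}, \dim {: V}).

HB.instance Definition _ (F : fieldType) (U V : vectType F) :=
  Vector.on (tensor U V).

Section Tensor.
Variables (F : fieldType) (U V : vectType F).

Definition tens (u : U) (v : V) : tensor U V :=
  \matrix_(i, j) (coord (vbasis {: U}) i u * coord (vbasis {: V}) j v).

Lemma tens_bilinear : is_bilinear tens.
Proof.
split=> w a x y; apply/matrixP=> i j; rewrite !mxE linearP /=.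
  by rewrite mulrDl mulrA.
by rewrite mulrDr mulrCA.
Qed.

Lemma tensPl a u u' v : tens (a *: u + u') v = a *: tens u v + tens u' v.
Proof. exact: tens_bilinear.1. Qed.

Lemma tensPr a u v v' : tens u (a *: v + v') = a *: tens u v + tens u v'.
Proof. exact: tens_bilinear.2. Qed.

Lemma tensDl u u' v : tens (u + u') v = tens u v + tens u' v.
Proof. by rewrite -{1}[u]scale1r tensPl scale1r. Qed.

Lemma tensDr u v v' : tens u (v + v') = tens u v + tens u v'.
Proof. by rewrite -{1}[v]scale1r tensPr scale1r. Qed.

Lemma tensBl u u' v : tens (u - u') v = tens u v - tens u' v.
Proof. by rewrite addrC -scaleN1r tensPl scaleN1r addrC. Qed.

Lemma tensBr u v v' : tens u (v - v') = tens u v - tens u v'.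
Proof. by rewrite addrC -scaleN1r tensPr scaleN1r addrC. Qed.

Section Lift.
Variable W : vectType F.

Definition tens_lift_fun (f : U -> V -> W) (t : tensor U V) : W :=
  \sum_i \sum_j t i j *: f (vbasis {: U})`_i (vbasis {: V})`_j.

Lemma tens_lift_fun_linear f : linear (tens_lift_fun f).
Proof.
move=> a s t; rewrite /tens_lift_fun scaler_sumr -big_split /=.
apply: eq_bigr => i _; rewrite scaler_sumr -big_split /=.
by apply: eq_bigr => j _; rewrite !mxE scalerDl scalerA.
Qed.

HB.instance Definition _ f := GRing.isLinear.Build F (tensor U V) W *:%R
  (tens_lift_fun f) (tens_lift_fun_linear f).

Definition tens_lift (f : U -> V -> W) : 'Hom(tensor U V, W) :=
  linfun (tens_lift_fun f).

Lemma tens_liftE f : is_bilinear f -> forall u v, tens_lift f (tens u v) = f u v.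
Proof.
move=> [fl fr] u v; rewrite lfunE /= /tens_lift_fun.
rewrite (linear_coord (fl v)); apply: eq_bigr => i _.
rewrite (linear_coord (fr _)) scaler_sumr; apply: eq_bigr => j _.
by rewrite mxE scalerA.
Qed.

Lemma tens_ext (f g : 'Hom(tensor U V, W)) :
  (forall u v, f (tens u v) = g (tens u v)) -> f = g.
Proof.
move=> efg; apply/lfunP=> t.
suff -> : t = \sum_i \sum_j t i j *: tens (vbasis {: U})`_i (vbasis {: V})`_j.
  rewrite !linear_sum; apply: eq_bigr => i _; rewrite !linear_sum.
  by apply: eq_bigr => j _; rewrite !linearZ /= efg.
rewrite [LHS]matrix_sum_delta; apply: eq_bigr => i _; apply: eq_bigr => j _.
congr (_ *: _); apply/matrixP=> k l; rewrite !mxE.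
rewrite !coord_free ?(basis_free (vbasisP _)) //.
by rewrite -natrM mulnb (eq_sym k) (eq_sym l).
Qed.

End Lift.
End Tensor.

Lemma tens_eq (F : fieldType) (U V W : vectType F) (f g : tensor U V -> W) :
  linear f -> linear g -> (forall u v, f (tens u v) = g (tens u v)) -> f =1 g.
Proof.
move=> fl gl efg t.
pose f' : {linear tensor U V -> W} :=
  HB.pack f (GRing.isLinear.Build F (tensor U V) W *:%R f fl).
pose g' : {linear tensor U V -> W} :=
  HB.pack g (GRing.isLinear.Build F (tensor U V) W *:%R g gl).
have <- : linfun f' t = f t by rewrite lfunE.
have <- : linfun g' t = g t by rewrite lfunE.
suff -> : linfun f' = linfun g' by [].
by apply: tens_ext => u v; rewrite !lfunE /= efg.
Qed.

Lemma tens_eq3l (F : fieldType) (U V W Y : vectType F)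
    (f g : tensor (tensor U V) W -> Y) :
  linear f -> linear g ->
  (forall u v w, f (tens (tens u v) w) = g (tens (tens u v) w)) -> f =1 g.
Proof.
move=> fl gl efg; apply: tens_eq => // t w; move: t.
by apply: tens_eq => [a s t|a s t|u v] /=; rewrite ?tensPl ?fl ?gl ?efg.
Qed.

Lemma tens_eq3r (F : fieldType) (U V W Y : vectType F)
    (f g : tensor U (tensor V W) -> Y) :
  linear f -> linear g ->
  (forall u v w, f (tens u (tens v w)) = g (tens u (tens v w))) -> f =1 g.
Proof.
move=> fl gl efg; apply: tens_eq => // u; apply: tens_eq => [a s t|a s t|v w];
  by rewrite /= ?tensPr ?fl ?gl ?efg.
Qed.

Section Constraints.
Variable F : fieldType.
Implicit Types U V W : vectType F.

Lemma lfun_lin U V (f : 'Hom(U, V)) : linear f.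
Proof. exact: linearP. Qed.

Lemma lfun_add U V (f : 'Hom(U, V)) u v : f (u + v) = f u + f v.
Proof. exact: linearD. Qed.

Definition tens_map U U' V V' (f : 'Hom(U, U')) (g : 'Hom(V, V')) :
    'Hom(tensor U V, tensor U' V') :=
  tens_lift (fun u v => tens (f u) (g v)).

Lemma tens_mapE U U' V V' (f : 'Hom(U, U')) (g : 'Hom(V, V')) u v :
  tens_map f g (tens u v) = tens (f u) (g v).
Proof.
by rewrite tens_liftE //; split=> w a s t; rewrite /= !lfun_lin ?tensPl ?tensPr.
Qed.

Definition tens_assoc U V W :
    'Hom(tensor (tensor U V) W, tensor U (tensor V W)) :=
  tens_lift (fun t w => tens_lift (fun u v => tens u (tens v w)) t).

Lemma tens_assocE U V W (u : U) (v : V) (w : W) :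
  tens_assoc U V W (tens (tens u v) w) = tens u (tens v w).
Proof.
have bil w' : is_bilinear (fun u' v' => tens u' (tens v' w') :
    tensor U (tensor V W)).
  by split=> x a s t; rewrite /= ?tensPl ?tensPr.
rewrite tens_liftE ?tens_liftE //; split=> [w'|t] a x y; first exact: lfun_lin.
move: t; apply: tens_eq => [b s t|b s t|u' v'].
- exact: lfun_lin.
- by rewrite /= !lfun_lin !scalerDr !scalerA !(mulrC a) addrACA.
by rewrite !tens_liftE // !tensPr.
Qed.

Definition tens_assocV U V W :
    'Hom(tensor U (tensor V W), tensor (tensor U V) W) :=
  tens_lift (fun u t => tens_lift (fun v w => tens (tens u v) w) t).

Lemma tens_assocVE U V W (u : U) (v : V) (w : W) :
  tens_assocV U V W (tens u (tens v w)) = tens (tens u v) w.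
Proof.
have bil u' : is_bilinear (fun v' w' => tens (tens u' v') w' :
    tensor (tensor U V) W).
  by split=> x a s t; rewrite /= ?tensPr ?tensPl.
rewrite tens_liftE ?tens_liftE //; split=> [t|u'] a x y; last exact: lfun_lin.
move: t; apply: tens_eq => [b s t|b s t|v' w'].
- exact: lfun_lin.
- by rewrite /= !lfun_lin !scalerDr !scalerA !(mulrC a) addrACA.
by rewrite !tens_liftE // !tensPl.
Qed.

Definition tens_lunit U : 'Hom(tensor F^o U, U) :=
  tens_lift (fun (c : F^o) u => c *: u).

Lemma tens_lunitE U c (u : U) : tens_lunit U (tens (c : F^o) u) = c *: u.
Proof.
rewrite tens_liftE //; split=> w a s t /=; first by rewrite scalerDl scalerA.
by rewrite scalerDr !scalerA mulrC.
Qed.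

Definition tens_runit U : 'Hom(tensor U F^o, U) :=
  tens_lift (fun u (c : F^o) => c *: u).

Lemma tens_runitE U c (u : U) : tens_runit U (tens u (c : F^o)) = c *: u.
Proof.
rewrite tens_liftE //; split=> w a s t /=; last by rewrite scalerDl scalerA.
by rewrite scalerDr !scalerA mulrC.
Qed.

Definition tens_flip U V : 'Hom(tensor U V, tensor V U) :=
  tens_lift (fun u v => tens v u).

Lemma tens_flipE U V (u : U) (v : V) : tens_flip U V (tens u v) = tens v u.
Proof.
by rewrite tens_liftE //; split=> w a s t; rewrite /= ?tensPl ?tensPr.
Qed.

End Constraints.

Definition mk_bilinear (F : fieldType) (U V W : lmodType F)
    (f : U -> V -> W) (fP : is_bilinear f) : {bilinear U -> V -> W} :=
  HB.pack f (bilinear_isBilinear.Build F U V W *:%R *:%R f fP).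

Record leibniz_algebra (F : fieldType) := LeibnizAlgebra {
  leib_sort :> lmodType F;
  leib_mul : {bilinear leib_sort -> leib_sort -> leib_sort};
  leib_identity : forall x y z,
    leib_mul x (leib_mul y z) =
    leib_mul (leib_mul x y) z + leib_mul y (leib_mul x z) }.

Arguments leib_mul {F} l.

Section WeakBimodules.
Variables (F : fieldType) (L : leibniz_algebra F).

Record fd_weak_bimodule := FdWeakBimodule {
  bimod_sort :> vectType F;
  lact : {bilinear L -> bimod_sort -> bimod_sort};
  ract : {bilinear bimod_sort -> L -> bimod_sort};
  bimod_LLM : forall (x y : L) m,
    lact (leib_mul L x y) m = lact x (lact y m) - lact y (lact x m);
  bimod_LML : forall (x y : L) m,
    ract (lact x m) y = lact x (ract m y) - ract m (leib_mul L x y) }.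

Record bimod_hom (M N : fd_weak_bimodule) := BimodHom {
  bimod_fun :> 'Hom(M, N);
  bimod_hom_lact : forall (x : L) m,
    bimod_fun (lact M x m) = lact N x (bimod_fun m);
  bimod_hom_ract : forall (x : L) m,
    bimod_fun (ract M m x) = ract N (bimod_fun m) x }.

Program Definition bimod_id M : bimod_hom M M := @BimodHom M M \1%VF _ _.
Next Obligation. by move=> M x m; rewrite !id_lfunE. Qed.
Next Obligation. by move=> M x m; rewrite !id_lfunE. Qed.

Program Definition bimod_comp M N P (g : bimod_hom N P) (f : bimod_hom M N) :
  bimod_hom M P := @BimodHom M P (g \o f)%VF _ _.
Next Obligation.
by move=> M N P g f x m; rewrite !comp_lfunE !bimod_hom_lact.
Qed.
Next Obligation.
by move=> M N P g f x m; rewrite !comp_lfunE !bimod_hom_ract.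
Qed.

Definition modbi_weak : cat_data :=
  @CatData fd_weak_bimodule bimod_hom bimod_id bimod_comp.

Section ActionTheory.
Variable M : fd_weak_bimodule.

Lemma lactPl a (x y : L) (m : M) :
  lact M (a *: x + y) m = a *: lact M x m + lact M y m.
Proof. exact: linearPl. Qed.

Lemma lactPr a (x : L) (m m' : M) :
  lact M x (a *: m + m') = a *: lact M x m + lact M x m'.
Proof. exact: linearPr. Qed.

Lemma ractPl a (m m' : M) (x : L) :
  ract M (a *: m + m') x = a *: ract M m x + ract M m' x.
Proof. exact: linearPl. Qed.

Lemma ractPr a (m : M) (x y : L) :
  ract M m (a *: x + y) = a *: ract M m x + ract M m y.
Proof. exact: linearPr. Qed.

End ActionTheory.

Let actP := (lactPl, lactPr, ractPl, ractPr, tensPl, tensPr, lfun_lin).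

Section TensorObject.
Variables M N : fd_weak_bimodule.

Definition tens_lact (x : L) : 'End(tensor M N) :=
  tens_lift (fun m n => tens (lact M x m) n + tens m (lact N x n)).

Definition tens_ract (t : tensor M N) (x : L) : tensor M N :=
  tens_lift (fun m n => tens (ract M m x) n + tens m (ract N n x)) t.

Lemma tens_lactE x m n :
  tens_lact x (tens m n) = tens (lact M x m) n + tens m (lact N x n).
Proof.
rewrite tens_liftE //; split=> w a u v;
  by rewrite /= !actP scalerDr addrACA.
Qed.

Lemma tens_ractE x m n :
  tens_ract (tens m n) x = tens (ract M m x) n + tens m (ract N n x).
Proof.
rewrite /tens_ract tens_liftE //; split=> w a u v;
  by rewrite /= !actP scalerDr addrACA.
Qed.

Lemma tens_lact_linear x : linear (tens_lact x).
Proof. exact: linearP. Qed.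

Lemma tens_lact_bilinear : is_bilinear tens_lact.
Proof.
split=> [t|x] a u v; last exact: tens_lact_linear.
move: t; apply: tens_eq => [b s t|b s t|m n].
- exact: tens_lact_linear.
- by rewrite /= !tens_lact_linear !scalerDr !scalerA !(mulrC a) addrACA.
by rewrite /= !tens_lactE !actP scalerDr addrACA.
Qed.

Lemma tens_ract_linear x : linear (tens_ract^~ x).
Proof. by move=> a s t; rewrite /tens_ract linearP. Qed.

Lemma tens_ract_bilinear : is_bilinear tens_ract.
Proof.
split=> [x|t] a u v; first exact: tens_ract_linear.
move: t; apply: tens_eq => [b s t|b s t|m n].
- exact: tens_ract_linear.
- by rewrite /= !tens_ract_linear !scalerDr !scalerA !(mulrC a) addrACA.
by rewrite /= !tens_ractE !actP scalerDr addrACA.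
Qed.

Let lactT := mk_bilinear tens_lact_bilinear.
Let ractT := mk_bilinear tens_ract_bilinear.

Let lactTD x s t : tens_lact x (s + t) = tens_lact x s + tens_lact x t.
Proof. exact: linearD. Qed.

Let ractTD x s t : tens_ract (s + t) x = tens_ract s x + tens_ract t x.
Proof. exact: linearD. Qed.

Lemma tens_LLM x y t : lactT (leib_mul L x y) t =
  lactT x (lactT y t) - lactT y (lactT x t).
Proof.
rewrite /=; move: t; apply: tens_eq => [a s t|a s t|m n].
- by rewrite !actP.
- by rewrite !actP scalerBr opprD addrACA.
rewrite !tens_lactE !lactTD !tens_lactE !bimod_LLM !(tensBl, tensBr).
rewrite [X in _ = X - _](AC (2*2) ((1*4)*(2*3))).
rewrite [X in _ = _ - X](AC (2*2) ((1*4)*(3*2))).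
by rewrite opprD [RHS]addrACA subrr addr0 opprD addrACA.
Qed.

Lemma tens_LML x y t : ractT (lactT x t) y =
  lactT x (ractT t y) - ractT t (leib_mul L x y).
Proof.
rewrite /=; move: t; apply: tens_eq => [a s t|a s t|m n].
- by rewrite !(actP, tens_ract_linear).
- by rewrite !(actP, tens_ract_linear) scalerBr opprD addrACA.
rewrite !(tens_lactE, tens_ractE) ractTD lactTD !(tens_lactE, tens_ractE).
rewrite !bimod_LML !(tensBl, tensBr) opprD.
by rewrite [RHS](AC ((2*2)*2) (((1*5)*3)*(2*(4*6)))).
Qed.

Definition tens_bimod : fd_weak_bimodule :=
  @FdWeakBimodule (tensor M N) lactT ractT tens_LLM tens_LML.

End TensorObject.

Fact zero_lact_bilinear : is_bilinear (fun (_ : L) (_ : F^o) => 0 : F^o).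
Proof. by split=> w a s t; rewrite /= scaler0 addr0. Qed.

Fact zero_ract_bilinear : is_bilinear (fun (_ : F^o) (_ : L) => 0 : F^o).
Proof. by split=> w a s t; rewrite /= scaler0 addr0. Qed.

Program Definition unit_bimod : fd_weak_bimodule :=
  @FdWeakBimodule F^o (mk_bilinear zero_lact_bilinear)
    (mk_bilinear zero_ract_bilinear) _ _.
Next Obligation. by move=> *; rewrite /= subr0. Qed.
Next Obligation. by move=> *; rewrite /= subr0. Qed.

Implicit Types (M N P : fd_weak_bimodule) (x y : L).

Lemma lact_tens M N x (m : M) (n : N) :
  lact (tens_bimod M N) x (tens m n) =
  tens (lact M x m) n + tens m (lact N x n).
Proof. exact: tens_lactE. Qed.

Lemma ract_tens M N x (m : M) (n : N) :
  ract (tens_bimod M N) (tens m n) x =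
  tens (ract M m x) n + tens m (ract N n x).
Proof. exact: tens_ractE. Qed.

Let lactTP M N x : linear (lact (tens_bimod M N) x).
Proof. by move=> a s t; exact: lactPr. Qed.

Let ractTP M N x : linear (fun t => ract (tens_bimod M N) t x).
Proof. by move=> a s t; exact: ractPl. Qed.

Program Definition bimod_tmor M M' N N'
    (f : bimod_hom M M') (g : bimod_hom N N') :
    bimod_hom (tens_bimod M N) (tens_bimod M' N') :=
  @BimodHom (tens_bimod M N) (tens_bimod M' N') (tens_map f g) _ _.
Next Obligation.
move=> M M' N N' f g x; apply: tens_eq => [a s t|a s t|m n].
- by rewrite !(lactTP, lfun_lin).
- by rewrite !(lactTP, lfun_lin).
by rewrite lact_tens lfun_add !tens_mapE lact_tens !bimod_hom_lact.
Qed.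
Next Obligation.
move=> M M' N N' f g x; apply: tens_eq => [a s t|a s t|m n].
- by rewrite !(ractTP, lfun_lin).
- by rewrite !(ractTP, lfun_lin).
by rewrite ract_tens lfun_add !tens_mapE ract_tens !bimod_hom_ract.
Qed.

Program Definition bimod_assoc M N P :
    bimod_hom (tens_bimod (tens_bimod M N) P) (tens_bimod M (tens_bimod N P)) :=
  @BimodHom (tens_bimod (tens_bimod M N) P) (tens_bimod M (tens_bimod N P))
    (tens_assoc M N P) _ _.
Next Obligation.
move=> M N P x; apply: tens_eq3l => [a s t|a s t|m n p].
- by rewrite !(lactTP, lfun_lin).
- by rewrite !(lactTP, lfun_lin).
by rewrite !lact_tens tensDl !lfun_add !tens_assocE !lact_tens tensDr addrA.
Qed.
Next Obligation.
move=> M N P x; apply: tens_eq3l => [a s t|a s t|m n p].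
- by rewrite !(ractTP, lfun_lin).
- by rewrite !(ractTP, lfun_lin).
by rewrite !ract_tens tensDl !lfun_add !tens_assocE !ract_tens tensDr addrA.
Qed.

Program Definition bimod_assocV M N P :
    bimod_hom (tens_bimod M (tens_bimod N P)) (tens_bimod (tens_bimod M N) P) :=
  @BimodHom (tens_bimod M (tens_bimod N P)) (tens_bimod (tens_bimod M N) P)
    (tens_assocV M N P) _ _.
Next Obligation.
move=> M N P x; apply: tens_eq3r => [a s t|a s t|m n p].
- by rewrite !(lactTP, lfun_lin).
- by rewrite !(lactTP, lfun_lin).
by rewrite !lact_tens tensDr !lfun_add !tens_assocVE !lact_tens tensDl addrA.
Qed.
Next Obligation.
move=> M N P x; apply: tens_eq3r => [a s t|a s t|m n p].
- by rewrite !(ractTP, lfun_lin).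
- by rewrite !(ractTP, lfun_lin).
by rewrite !ract_tens tensDr !lfun_add !tens_assocVE !ract_tens tensDl addrA.
Qed.

Program Definition bimod_lunit M : bimod_hom (tens_bimod unit_bimod M) M :=
  @BimodHom (tens_bimod unit_bimod M) M (tens_lunit M) _ _.
Next Obligation.
move=> M x; apply: tens_eq => [a s t|a s t|c m].
- by rewrite !(lactTP, lfun_lin).
- by rewrite !(lfun_lin, lactPr).
by rewrite lact_tens lfun_add !tens_lunitE scale0r add0r linearZr.
Qed.
Next Obligation.
move=> M x; apply: tens_eq => [a s t|a s t|c m].
- by rewrite !(ractTP, lfun_lin).
- by rewrite !(lfun_lin, ractPl).
by rewrite ract_tens lfun_add !tens_lunitE scale0r add0r linearZl_LR.
Qed.

Program Definition bimod_runit M : bimod_hom (tens_bimod M unit_bimod) M :=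
  @BimodHom (tens_bimod M unit_bimod) M (tens_runit M) _ _.
Next Obligation.
move=> M x; apply: tens_eq => [a s t|a s t|m c].
- by rewrite !(lactTP, lfun_lin).
- by rewrite !(lfun_lin, lactPr).
by rewrite lact_tens lfun_add !tens_runitE scale0r addr0 linearZr.
Qed.
Next Obligation.
move=> M x; apply: tens_eq => [a s t|a s t|m c].
- by rewrite !(ractTP, lfun_lin).
- by rewrite !(lfun_lin, ractPl).
by rewrite ract_tens lfun_add !tens_runitE scale0r addr0 linearZl_LR.
Qed.

Program Definition bimod_flip M N :
    bimod_hom (tens_bimod M N) (tens_bimod N M) :=
  @BimodHom (tens_bimod M N) (tens_bimod N M) (tens_flip M N) _ _.
Next Obligation.
move=> M N x; apply: tens_eq => [a s t|a s t|m n].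
- by rewrite !(lactTP, lfun_lin).
- by rewrite !(lactTP, lfun_lin).
by rewrite lact_tens lfun_add !tens_flipE lact_tens addrC.
Qed.
Next Obligation.
move=> M N x; apply: tens_eq => [a s t|a s t|m n].
- by rewrite !(ractTP, lfun_lin).
- by rewrite !(ractTP, lfun_lin).
by rewrite ract_tens lfun_add !tens_flipE ract_tens addrC.
Qed.

Definition modbi_weak_tensor : symmetric_monoidal_data modbi_weak :=
  @SymmetricMonoidalData modbi_weak tens_bimod bimod_tmor unit_bimod
    bimod_assoc bimod_assocV bimod_lunit bimod_runit bimod_flip.

End WeakBimodules.

(* Main.v *)
(* Every equation between morphisms out of a tensor product is checked on pure
   tensors, where the constraints act as in vector spaces. Every M has M^* as a
   dual, with evaluation mu (x) m |-> mu m and coevaluation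
   1 |-> \sum_i e_i (x) e_i^*. The latter is a morphism from the trivial
   bimodule because \sum_i phi e_i (x) e_i^* = \sum_i e_i (x) (e_i^* o phi) for
   each endomorphism phi of M: applied to the action of an element of L on M,
   and with the sign in the action on M^*, this says that L kills the
   coevaluation element on both sides. Composing with the flip makes M^* a dual
   on the other side as well. *)

Require Import Defs.
From HB Require Import structures.
From mathcomp Require Import all_boot all_order all_algebra.
From Stdlib Require Import ProofIrrelevance.

Set Implicit Arguments.
Unset Strict Implicit.
Unset Printing Implicit Defensive.

Import GRing.Theory.
Local Open Scope ring_scope.

Local Notation is_bilinear f := (bilinear_for *:%R *:%R f).

(** * Dual bases, coevaluation and evaluation for vector spaces *)

Section LinearDual.
Variables (F : fieldType) (M : vectType F).

Local Notation e := (vbasis {: M}).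

Definition dual_basis (i : 'I_(\dim {: M})) : 'Hom(M, F^o) :=
  linfun (coord e i : M -> F^o).

Lemma dual_basisE i m : dual_basis i m = coord e i m.
Proof. by rewrite lfunE. Qed.

Lemma dual_basis_sum_vect m : \sum_i dual_basis i m *: e`_i = m.
Proof.
rewrite [RHS](coord_vbasis (memvf m)).
by apply: eq_bigr => i _; rewrite dual_basisE.
Qed.

(** Evaluate both sides at m and expand m in the basis inside [mu m]. *)
Lemma dual_basis_sum_form (mu : 'Hom(M, F^o)) :
  \sum_(i < _) (mu e`_i : F) *: dual_basis i = mu.
Proof.
apply/lfunP => m; rewrite sum_lfunE -[in RHS](dual_basis_sum_vect m) linear_sum.
by apply: eq_bigr => i _; rewrite scale_lfunE linearZ /= /GRing.scale /= mulrC.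
Qed.

Lemma tens0l (U V : vectType F) (v : V) : tens (0 : U) v = 0.
Proof. by rewrite -[X in tens X](subrr (0 : U)) tensBl subrr. Qed.

Lemma tens0r (U V : vectType F) (u : U) : tens u (0 : V) = 0.
Proof. by rewrite -[X in tens _ X](subrr (0 : V)) tensBr subrr. Qed.

Lemma tensZl (U V : vectType F) a (u : U) (v : V) :
  tens (a *: u) v = a *: tens u v.
Proof. by rewrite -[a *: u]addr0 tensPl tens0l addr0. Qed.

Lemma tensZr (U V : vectType F) a (u : U) (v : V) :
  tens u (a *: v) = a *: tens u v.
Proof. by rewrite -[a *: v]addr0 tensPr tens0r addr0. Qed.

Lemma tens_suml (U V : vectType F) I (r : seq I) (f : I -> U) (v : V) :
  tens (\sum_(i <- r) f i) v = \sum_(i <- r) tens (f i) v.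
Proof.
by apply: (big_morph (fun u => tens u v)) => [x y|]; rewrite ?tensDl ?tens0l.
Qed.

Lemma tens_sumr (U V : vectType F) I (r : seq I) (u : U) (f : I -> V) :
  tens u (\sum_(i <- r) f i) = \sum_(i <- r) tens u (f i).
Proof.
by apply: (big_morph (tens u)) => [x y|]; rewrite ?tensDr ?tens0r.
Qed.

Definition coev_elt : tensor M 'Hom(M, F^o) :=
  \sum_(i < _) tens e`_i (dual_basis i).

Lemma coev_elt_endo (phi : 'End(M)) :
  \sum_(i < _) tens (phi e`_i) (dual_basis i) =
  \sum_(i < _) tens e`_i (dual_basis i \o phi)%VF.
Proof.
(* The coefficients are the matrix entries of [phi]. Expanding each [phi e_i] in the basis gives
   this double sum; exchanging the sums and collecting the forms for fixed j gives the right
   side. *)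
transitivity (\sum_(i < _) \sum_(j < _)
    (dual_basis j (phi e`_i) : F) *: tens e`_j (dual_basis i)).
  apply: eq_bigr => i _; rewrite -{1}[phi _]dual_basis_sum_vect tens_suml.
  by apply: eq_bigr => j _; rewrite tensZl.
rewrite exchange_big; apply: eq_bigr => j _ /=.
rewrite -[in RHS](dual_basis_sum_form (dual_basis j \o phi)%VF) tens_sumr.
by apply: eq_bigr => i _; rewrite tensZr comp_lfunE.
Qed.

(** Each summand has the shape of an action on a tensor of M with its dual, the minus sign being
    that of the dual action; taking a left or a right action for [phi] covers both sides at once. *)
Lemma coev_elt_invariant (phi : 'End(M)) :
  \sum_(i < _) (tens (phi e`_i) (dual_basis i) +
    tens e`_i (- (dual_basis i \o phi))%VF) = 0.
Proof.
rewrite big_split /= coev_elt_endo -big_split big1 //= => i _.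
by rewrite -tensDr subrr tens0r.
Qed.

Definition tens_coev_fun (c : F^o) : tensor M 'Hom(M, F^o) := c *: coev_elt.

Fact tens_coev_fun_linear : linear tens_coev_fun.
Proof. by move=> a c d; rewrite /tens_coev_fun scalerDl scalerA. Qed.

HB.instance Definition _ := GRing.isLinear.Build F F^o
  (tensor M 'Hom(M, F^o)) *:%R tens_coev_fun tens_coev_fun_linear.

Definition tens_coev : 'Hom(F^o, tensor M 'Hom(M, F^o)) := linfun tens_coev_fun.

Lemma tens_coevE c : tens_coev c = c *: coev_elt.
Proof. exact: lfunE. Qed.

Definition tens_ev : 'Hom(tensor 'Hom(M, F^o) M, F^o) :=
  tens_lift (fun (mu : 'Hom(M, F^o)) m => mu m).

Lemma tens_evE mu m : tens_ev (tens mu m) = mu m.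
Proof.
rewrite tens_liftE //; split=> [n|nu] a x y /=; last exact: linearP.
by rewrite add_lfunE scale_lfunE.
Qed.

End LinearDual.

(** * The dual weak bimodule, with coevaluation and evaluation as morphisms *)

Section DualBimodule.
Variables (F : fieldType) (L : leibniz_algebra F).

(** A morphism bundles a linear map with two compatibility proofs. Proof irrelevance identifies the
    proofs, so only the linear maps have to be compared. *)
Lemma bimod_hom_eq (M N : fd_weak_bimodule L) (f g : bimod_hom M N) :
  f =1 g -> f = g.
Proof.
case: f g => [f fl fr] [g gl gr] /= /lfunP efg.
rewrite -efg in gl gr *.
by rewrite (proof_irrelevance _ fl gl) (proof_irrelevance _ fr gr).
Qed.

Variable M : fd_weak_bimodule L.

(** Packaging the action of a fixed x as an endomorphism makes the dual actions compositions and
    lets [coev_elt_invariant] apply to them. *)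
Definition lact_end (x : L) : 'End(M) := linfun (lact M x).
Definition ract_end (x : L) : 'End(M) := linfun (applyr (ract M) x).

Lemma lact_endE x m : lact_end x m = lact M x m.
Proof. exact: lfunE. Qed.

Lemma ract_endE x m : ract_end x m = ract M m x.
Proof. exact: lfunE. Qed.

Definition dual_lact (x : L) (mu : 'Hom(M, F^o)) : 'Hom(M, F^o) :=
  - (mu \o lact_end x)%VF.
Definition dual_ract (mu : 'Hom(M, F^o)) (x : L) : 'Hom(M, F^o) :=
  - (mu \o ract_end x)%VF.

Lemma dual_lactE x mu m : dual_lact x mu m = - mu (lact M x m).
Proof. by rewrite opp_lfunE comp_lfunE lact_endE. Qed.

Lemma dual_ractE mu x m : dual_ract mu x m = - mu (ract M m x).
Proof. by rewrite opp_lfunE comp_lfunE ract_endE. Qed.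

Fact dual_lact_bilinear : is_bilinear dual_lact.
Proof.
split=> w a u v; apply/lfunP => m;
  by rewrite !(dual_lactE, add_lfunE, scale_lfunE) /= ?lactPl ?linearP.
Qed.

Fact dual_ract_bilinear : is_bilinear dual_ract.
Proof.
split=> w a u v; apply/lfunP => m;
  by rewrite !(dual_ractE, add_lfunE, scale_lfunE) /= ?ractPr ?linearP.
Qed.

(** Dualising reverses the order of the two actions, which negates their commutator; this matches
    the single sign on the left, while the double signs on the right cancel. *)
Fact dual_LLM x y mu : dual_lact (leib_mul L x y) mu =
  dual_lact x (dual_lact y mu) - dual_lact y (dual_lact x mu).
Proof.
apply/lfunP => m; rewrite dual_lactE add_lfunE.
rewrite [X in _ = _ + X]opp_lfunE !dual_lactE bimod_LLM.
by rewrite linearB /= !opprK opprB.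
Qed.

(** At m the left side is [mu (x (m y))] and the right side is [mu ((x m) y) + mu (m (x y))]: this
    is [mu] applied to LML for M, with one term moved across. *)
Fact dual_LML x y mu : dual_ract (dual_lact x mu) y =
  dual_lact x (dual_ract mu y) - dual_ract mu (leib_mul L x y).
Proof.
apply/lfunP => m.
rewrite dual_ractE add_lfunE [X in _ = _ + X]opp_lfunE.
rewrite !(dual_lactE, dual_ractE) !opprK.
by rewrite bimod_LML linearB subrK.
Qed.

Definition dual_bimod : fd_weak_bimodule L :=
  @FdWeakBimodule F L 'Hom(M, F^o) (mk_bilinear dual_lact_bilinear)
    (mk_bilinear dual_ract_bilinear) dual_LLM dual_LML.

Lemma lact_coev_elt x : lact (tens_bimod M dual_bimod) x (coev_elt M) = 0.
Proof.
rewrite -[RHS](coev_elt_invariant (lact_end x)) linear_sumr.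
by apply: eq_bigr => i _; rewrite lact_tens lact_endE.
Qed.

Lemma ract_coev_elt x : ract (tens_bimod M dual_bimod) (coev_elt M) x = 0.
Proof.
rewrite -[RHS](coev_elt_invariant (ract_end x)) linear_sumlz.
by apply: eq_bigr => i _; rewrite ract_tens ract_endE.
Qed.

Program Definition bimod_coev :
    bimod_hom (unit_bimod L) (tens_bimod M dual_bimod) :=
  @BimodHom F L (unit_bimod L) (tens_bimod M dual_bimod) (tens_coev M) _ _.
Next Obligation.
(* The action on the unit object computes to 0, so the left side is the image of 0; the right side
   is c times the action on an invariant element. *)
by move=> x c; rewrite [LHS]linear0 tens_coevE linearZr_LR lact_coev_elt scaler0.
Qed.
Next Obligation.
by move=> x c; rewrite [LHS]linear0 tens_coevE linearZl_LR ract_coev_elt scaler0.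
Qed.

Program Definition bimod_ev :
    bimod_hom (tens_bimod dual_bimod M) (unit_bimod L) :=
  @BimodHom F L (tens_bimod dual_bimod M) (unit_bimod L) (tens_ev M) _ _.
Next Obligation.
move=> x; apply: tens_eq => [a s t|a s t|mu m].
- by rewrite lactPr lfun_lin.
- by rewrite lfun_lin lactPr.
(* The sign in the dual action cancels the two terms, which leaves the zero action of the unit
   object. *)
by rewrite lact_tens lfun_add !tens_evE [_ m]dual_lactE addNr.
Qed.
Next Obligation.
move=> x; apply: tens_eq => [a s t|a s t|mu m].
- by rewrite ractPl lfun_lin.
- by rewrite lfun_lin ractPl.
by rewrite ract_tens lfun_add !tens_evE [_ m]dual_ractE addNr.
Qed.

End DualBimodule.

(** * Coherence laws and zigzag identities on pure tensors *)

Section RigidSymmetricMonoidal.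
Variables (F : fieldType) (L : leibniz_algebra F).
Implicit Types M N P Q : fd_weak_bimodule L.

Lemma bimod_hom_tens_eq M N Q (f g : bimod_hom (tens_bimod M N) Q) :
  (forall m n, f (tens m n) = g (tens m n)) -> f = g.
Proof.
by move=> fg; apply: bimod_hom_eq; apply: tens_eq fg; exact: lfun_lin.
Qed.

Lemma bimod_hom_tens_eq3l M N P Q
    (f g : bimod_hom (tens_bimod (tens_bimod M N) P) Q) :
  (forall m n p, f (tens (tens m n) p) = g (tens (tens m n) p)) -> f = g.
Proof.
by move=> fg; apply: bimod_hom_eq; apply: tens_eq3l fg; exact: lfun_lin.
Qed.

Lemma bimod_hom_tens_eq3r M N P Q
    (f g : bimod_hom (tens_bimod M (tens_bimod N P)) Q) :
  (forall m n p, f (tens m (tens n p)) = g (tens m (tens n p))) -> f = g.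
Proof.
by move=> fg; apply: bimod_hom_eq; apply: tens_eq3r fg; exact: lfun_lin.
Qed.

(** The pentagon starts from a fourfold tensor product. Freezing the last factor reduces this case
    to three factors. *)
Lemma bimod_hom_tens_eq4 M N P Q R
    (f g : bimod_hom (tens_bimod (tens_bimod (tens_bimod M N) P) Q) R) :
  (forall m n p q, f (tens (tens (tens m n) p) q) =
                   g (tens (tens (tens m n) p) q)) -> f = g.
Proof.
move=> fg; apply: bimod_hom_tens_eq => t q; move: t.
by apply: tens_eq3l => [a s t|a s t|m n p] //; rewrite tensPl lfun_lin.
Qed.

Let tensE := (tens_mapE, tens_assocE, tens_assocVE, tens_lunitE, tens_runitE,
  tens_flipE, id_lfunE).

Lemma modbi_weak_category : is_category (modbi_weak L).
Proof.
by split=> *; apply: bimod_hom_eq => m; rewrite /= !(comp_lfunE, id_lfunE).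
Qed.

(** The map [m |-> 1 (x) m], linear as a partial application of the bilinear [tens]. It respects the
    actions because the term in which L acts on 1 vanishes. *)
Program Definition bimod_lunitV M :
    bimod_hom M (tens_bimod (unit_bimod L) M) :=
  @BimodHom F L M (tens_bimod (unit_bimod L) M)
    (linfun (mk_bilinear (@tens_bilinear F F^o M) 1)) _ _.
Next Obligation.
move=> M x m; rewrite !lfunE /= [RHS](@lact_tens F L (unit_bimod L) M).
by rewrite tens0l add0r.
Qed.
Next Obligation.
move=> M x m; rewrite !lfunE /= [RHS](@ract_tens F L (unit_bimod L) M).
by rewrite tens0l add0r.
Qed.

Program Definition bimod_runitV M :
    bimod_hom M (tens_bimod M (unit_bimod L)) :=
  @BimodHom F L M (tens_bimod M (unit_bimod L))
    (linfun (applyr (mk_bilinear (@tens_bilinear F M F^o)) 1)) _ _.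
Next Obligation.
move=> M x m; rewrite !lfunE /= [RHS](@lact_tens F L M (unit_bimod L)).
by rewrite tens0r addr0.
Qed.
Next Obligation.
move=> M x m; rewrite !lfunE /= [RHS](@ract_tens F L M (unit_bimod L)).
by rewrite tens0r addr0.
Qed.

Lemma bimod_lunit_inverse M :
  inverse_mor (C := modbi_weak L) (bimod_lunit M) (bimod_lunitV M).
Proof.
have lunitVE m : bimod_lunitV M m = tens (1 : F^o) m by exact: lfunE.
split; last first.
  apply: bimod_hom_eq => m.
  by rewrite [LHS]comp_lfunE lunitVE tens_lunitE scale1r id_lfunE.
apply: bimod_hom_tens_eq => c m.
rewrite [LHS]comp_lfunE lunitVE tens_lunitE id_lfunE.
(* The scalar crosses the tensor sign, and scaling 1 by c in [F^o] is multiplication, so it gives c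
   back. *)
by rewrite tensZr -tensZl /GRing.scale /= mulr1.
Qed.

Lemma bimod_runit_inverse M :
  inverse_mor (C := modbi_weak L) (bimod_runit M) (bimod_runitV M).
Proof.
have runitVE m : bimod_runitV M m = tens m (1 : F^o) by exact: lfunE.
split; last first.
  apply: bimod_hom_eq => m.
  by rewrite [LHS]comp_lfunE runitVE tens_runitE scale1r id_lfunE.
apply: bimod_hom_tens_eq => m c.
rewrite [LHS]comp_lfunE runitVE tens_runitE id_lfunE.
by rewrite tensZl -tensZr /GRing.scale /= mulr1.
Qed.

Lemma modbi_weak_monoidal : is_monoidal (modbi_weak_tensor L).
Proof.
split.
- by move=> X Y; apply: bimod_hom_tens_eq => x y; rewrite /= !tensE.
- move=> X X' X'' Y Y' Y'' f' f g' g; apply: bimod_hom_tens_eq => x y.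
  by rewrite /= !comp_lfunE !tensE !comp_lfunE.
- move=> X Y Z; split; [apply: bimod_hom_tens_eq3l|apply: bimod_hom_tens_eq3r];
    by move=> x y z; rewrite /= !comp_lfunE !tensE.
- move=> X X' Y Y' Z Z' f g h; apply: bimod_hom_tens_eq3l => x y z.
  by rewrite /= !comp_lfunE !tensE.
- by move=> X; exists (bimod_lunitV X); exact: bimod_lunit_inverse.
- move=> X X' f; apply: bimod_hom_tens_eq => c x.
  by rewrite /= !comp_lfunE !tensE linearZ.
- by move=> X; exists (bimod_runitV X); exact: bimod_runit_inverse.
- move=> X X' f; apply: bimod_hom_tens_eq => x c.
  by rewrite /= !comp_lfunE !tensE linearZ.
- move=> W X Y Z; apply: bimod_hom_tens_eq4 => w x y z.
  by rewrite /= !comp_lfunE !tensE.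
- move=> X Y; apply: bimod_hom_tens_eq3l => x c y.
  (* The triangle says that the middle scalar c may be absorbed by either neighbour. *)
  by rewrite /= !comp_lfunE !tensE tensZl tensZr.
Qed.

Lemma modbi_weak_symmetric : is_symmetric (modbi_weak_tensor L).
Proof.
split.
- move=> X X' Y Y' f g; apply: bimod_hom_tens_eq => x y.
  by rewrite /= !comp_lfunE !tensE.
- move=> X Y Z; apply: bimod_hom_tens_eq3l => x y z.
  by rewrite /= !comp_lfunE !tensE.
- move=> X Y Z; apply: bimod_hom_tens_eq3r => x y z.
  by rewrite /= !comp_lfunE !tensE.
- move=> X Y; apply: bimod_hom_tens_eq => x y.
  by rewrite /= !comp_lfunE !tensE.
Qed.

(** Once the scalar c is factored out, the first zigzag is the expansion of a vector in the basis
    and the second is the expansion of a form in the dual basis. *)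
Lemma dual_bimod_left M : is_left_dual (modbi_weak_tensor L) M (dual_bimod M).
Proof.
exists (bimod_ev M), (bimod_coev M); split; apply: bimod_hom_tens_eq.
- move=> c m; rewrite /= !comp_lfunE !tensE tens_coevE tensZl tens_suml.
  rewrite !linearZ !linear_sum /=; congr (_ *: _).
  rewrite -[RHS]dual_basis_sum_vect; apply: eq_bigr => i _.
  by rewrite tens_assocE tens_mapE tens_evE id_lfunE; exact: tens_runitE.
- move=> mu c; rewrite /= !comp_lfunE !tensE tens_coevE tensZr tens_sumr.
  rewrite !linearZ !linear_sum /=; congr (_ *: _).
  rewrite -[RHS]dual_basis_sum_form; apply: eq_bigr => i _.
  by rewrite tens_assocVE tens_mapE tens_evE id_lfunE; exact: tens_lunitE.
Qed.

(** The flips only exchange the factors of each summand of the coevaluation and the arguments of the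
    evaluation, so the zigzags reduce to the same two expansions. *)
Lemma dual_bimod_right M : is_right_dual (modbi_weak_tensor L) M (dual_bimod M).
Proof.
exists (bimod_comp (bimod_ev M) (bimod_flip M (dual_bimod M))),
  (bimod_comp (bimod_flip M (dual_bimod M)) (bimod_coev M)).
split; apply: bimod_hom_tens_eq.
- move=> m c; rewrite /= !comp_lfunE !tensE comp_lfunE tens_coevE linearZ /=.
  rewrite linear_sum tensZr tens_sumr !linearZ !linear_sum /=.
  congr (_ *: _); rewrite -[RHS]dual_basis_sum_vect; apply: eq_bigr => i _.
  rewrite tens_flipE tens_assocVE tens_mapE comp_lfunE tens_flipE tens_evE.
  by rewrite id_lfunE; exact: tens_lunitE.
- move=> c mu; rewrite /= !comp_lfunE !tensE comp_lfunE tens_coevE linearZ /=.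
  rewrite linear_sum tensZl tens_suml !linearZ !linear_sum /=.
  congr (_ *: _); rewrite -[RHS]dual_basis_sum_form; apply: eq_bigr => i _.
  rewrite tens_flipE tens_assocE tens_mapE comp_lfunE tens_flipE tens_evE.
  by rewrite id_lfunE; exact: tens_runitE.
Qed.

End RigidSymmetricMonoidal.

Theorem theorem3p24 (F : fieldType) (L : leibniz_algebra F) :
  is_rigid_symmetric_monoidal_category (modbi_weak_tensor L).
Proof.
split; [exact: modbi_weak_category|exact: modbi_weak_monoidal|
  exact: modbi_weak_symmetric|].
by move=> M; split; exists (dual_bimod M);
  [exact: dual_bimod_left|exact: dual_bimod_right].
Qed.
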